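(* (a) A polynomial ideal (hyper-ideal) $\mathcal{Q}$ is injective if and only if $\mathcal{Q}=\mathcal{Q}^{inj}$. (b) A normed (Banach) polynomial ideal (hyper-ideal) $(\mathcal{Q},\|\cdot\|_{\mathcal{Q}})$ is injective if and only if $\mathcal{Q}=\mathcal{Q}^{inj}$ isometrically, that is, $\mathcal{Q}=\mathcal{Q}^{inj}$ and $\|\cdot\|_{\mathcal{Q}}=\|\cdot\|_{\mathcal{Q}^{inj}}$.
   Context: All Banach spaces are over $\mathbb{K}=\mathbb{R}$ or $\mathbb{C}$. For Banach spaces $E,F$ and $m\in\mathbb{N}$, $\mathcal{L}(E;F)$ is the space of bounded linear operators and $\mathcal{P}(^mE;F)$ the space of continuous $m$-homogeneous polynomials from $E$ to $F$, with the usual sup norm over the closed unit ball. Polynomials of finite type are the finite sums $x\mapsto\sum_i \varphi_i(x)^m y_i$ with $\varphi_i\in E^*$, $y_i\in F$. A polynomial ideal is a class $\mathcal{Q}$ of continuous homogeneous polynomials between Banach spaces such that each component $\mathcal{Q}(^mE;F):=\mathcal{P}(^mE;F)\cap\mathcal{Q}$ is a linear subspace of $\mathcal{P}(^mE;F)$ containing the polynomials of finite type, and $t\circ P\circ u\in\mathcal{Q}(^mE;H)$ whenever $t\in\mathcal{L}(G;H)$, $P\in\mathcal{Q}(^mF;G)$, $u\in\mathcal{L}(E;F)$. It is a polynomial hyper-ideal if $t\circ P\circ Q\in\mathcal{Q}(^{mn}E;H)$ whenever $t\in\mathcal{L}(G;H)$, $P\in\mathcal{Q}(^mF;G)$, $Q\in\mathcal{P}(^nE;F)$.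 Let $\|\cdot\|_{\mathcal{Q}}\colon\mathcal{Q}\to\mathbb{R}$ restrict to a norm on each component and satisfy $\|\lambda\in\mathbb{K}\mapsto\lambda^m\|_{\mathcal{Q}}=1$ for every $m$. Then $(\mathcal{Q},\|\cdot\|_{\mathcal{Q}})$ is a normed polynomial ideal if $\|t\circ P\circ u\|_{\mathcal{Q}}\le\|t\|\cdot\|P\|_{\mathcal{Q}}\cdot\|u\|^m$ for $t,P,u$ as in the ideal condition; it is a normed polynomial hyper-ideal if $\|t\circ P\circ Q\|_{\mathcal{Q}}\le\|t\|\cdot\|P\|_{\mathcal{Q}}\cdot\|Q\|^m$ for $t,P,Q$ as in the hyper-ideal condition. It is Banach if every component $(\mathcal{Q}(^mE;F),\|\cdot\|_{\mathcal{Q}})$ is a Banach space. A metric injection is a linear operator $j\colon F\to G$ with $\|j(y)\|=\|y\|$ for all $y\in F$. A polynomial ideal (or hyper-ideal) $\mathcal{Q}$ is injective if $P\in\mathcal{Q}(^mE;F)$ whenever $P\in\mathcal{P}(^mE;F)$ and $j\colon F\to G$ is a metric injection with $j\circ P\in\mathcal{Q}(^mE;G)$; a normed one is injective if, in addition, $\|P\|_{\mathcal{Q}}=\|j\circ P\|_{\mathcal{Q}}$ in this situation. Canonical metric injection: $I_F\colon F\to\ell_\infty(B_{F^*})$, $I_F(y)=(\varphi(y))_{\varphi\in B_{F^*}}$, where $B_{F^*}$ is the closed unit ball of $F^*$ and $\ell_\infty(B_{F^*})$ is the space of bounded scalar functions on $B_{F^*}$ with the sup norm. Injective hull: $\mathcal{Q}^{inj}(^mE;F)=\{P\in\mathcal{P}(^mE;F):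 I_F\circ P\in\mathcal{Q}(^mE;\ell_\infty(B_{F^*}))\}$ and, in the normed case, $\|P\|_{\mathcal{Q}^{inj}}:=\|I_F\circ P\|_{\mathcal{Q}}$. *)

(* Defs.v *)
From Stdlib Require Import Reals Lra Classical ClassicalEpsilon
  FunctionalExtensionality PropExtensionality ProofIrrelevance.
From Stdlib Require Fin.
From Coquelicot Require Import Coquelicot.

Set Implicit Arguments.
Unset Strict Implicit.
Unset Printing Implicit Defensive.

Open Scope R_scope.

(** Only meaningful for bounded sets; the supremum of the empty set is [0]. *)
Definition supR (S : R -> Prop) : R := real (Lub_Rbar S).

Lemma supR_ge (S : R -> Prop) (M r : R) :
  (forall s, S s -> s <= M) -> S r -> r <= supR S.
Proof.
intros HM Hr. unfold supR, Lub_Rbar.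
destruct (ex_lub_Rbar S) as [l [ub least]]; simpl.
assert (H1 := ub r Hr).
assert (H2 : Rbar_le l M) by (apply least; intros s Hs; exact (HM s Hs)).
destruct l; simpl in *; easy.
Qed.

Lemma supR_le (S : R -> Prop) (M : R) :
  0 <= M -> (forall s, S s -> s <= M) -> supR S <= M.
Proof.
intros M0 HM. unfold supR, Lub_Rbar.
destruct (ex_lub_Rbar S) as [l [ub least]]; simpl.
assert (H2 : Rbar_le l M) by (apply least; intros s Hs; exact (HM s Hs)).
destruct l; simpl in *; easy.
Qed.

Lemma supR_ge0 (S : R -> Prop) (M : R) :
  (forall s, S s -> 0 <= s <= M) -> 0 <= supR S.
Proof.
intros HS. destruct (classic (exists r, S r)) as [[r Hr]|none].
- apply Rle_trans with r. apply HS, Hr.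
  apply supR_ge with M; trivial. intros s Hs; apply HS, Hs.
- unfold supR, Lub_Rbar. destruct (ex_lub_Rbar S) as [l [ub least]]; simpl.
  assert (H : Rbar_le l m_infty).
  { apply least. intros s Hs. destruct none. now exists s. }
  destruct l; simpl in *; try easy; lra.
Qed.

Definition has_cauchy_limits (T : UniformSpace) : Prop :=
  forall F : (T -> Prop) -> Prop, ProperFilter F -> cauchy F ->
    exists l : T, forall eps : posreal, F (ball l eps).

Section CompleteMixin.

Variables (T : UniformSpace) (HT : has_cauchy_limits T).

Lemma cauchy_limit_total (F : (T -> Prop) -> Prop) :
  exists l : T, ProperFilter F -> cauchy F -> forall eps : posreal, F (ball l eps).
Proof.
destruct (classic (ProperFilter F /\ cauchy F)) as [[PF cF]|no].
- destruct (HT PF cF) as [l Hl]. now exists l.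
- exists (UniformSpace.point_of T (UniformSpace.class T)). tauto.
Qed.

Definition cauchy_limit (F : (T -> Prop) -> Prop) : T :=
  proj1_sig (constructive_indefinite_description _ (cauchy_limit_total F)).

Lemma cauchy_limit_ball (F : (T -> Prop) -> Prop) :
  ProperFilter F -> cauchy F -> forall eps : posreal, F (ball (cauchy_limit F) eps).
Proof.
exact (proj2_sig (constructive_indefinite_description _ (cauchy_limit_total F))).
Qed.

Lemma cauchy_limit_close (F1 F2 : (T -> Prop) -> Prop) :
  filter_le F1 F2 -> filter_le F2 F1 -> close (cauchy_limit F1) (cauchy_limit F2).
Proof.
intros H1 H2. replace F2 with F1. intros eps; apply ball_center.
apply functional_extensionality; intros A.
apply propositional_extensionality; split; [apply H2 | apply H1].
Qed.

Definition cauchy_complete_mixin : CompleteSpace.mixin_of T :=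
  CompleteSpace.Mixin T cauchy_limit cauchy_limit_ball cauchy_limit_close.

End CompleteMixin.

Inductive scalar_field := RealScalars | ComplexScalars.

Definition scalars (k : scalar_field) : AbsRing :=
  match k with RealScalars => R_AbsRing | ComplexScalars => C_AbsRing end.

Lemma complex_cauchy_limits : has_cauchy_limits (AbsRing_UniformSpace C_AbsRing).
Proof.
intros F PF cF.
pose proof (@complete_cauchy C_CompleteNormedModule F PF) as H.
assert (cF' : @cauchy C_UniformSpace F).
{ intros eps. destruct (cF eps) as [x Hx]. exists x.
  apply (filter_imp (F := F)) with (2 := Hx). intros y Hy.
  apply (@norm_compat1 C_AbsRing C_NormedModule). exact Hy. }
exists (lim (F : (C_CompleteNormedModule -> Prop) -> Prop)). intros eps.
set (c := @norm_factor C_AbsRing C_NormedModule).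
assert (c0 : 0 < c) by apply norm_factor_gt_0.
assert (e0 : 0 < eps / c) by (apply Rdiv_lt_0_compat; [apply cond_pos | trivial]).
apply (filter_imp (F := F)) with (2 := H cF' (mkposreal _ e0)).
intros y Hy. apply (@norm_compat2 C_AbsRing C_NormedModule) in Hy.
fold c in Hy. simpl in Hy. unfold ball; simpl; unfold AbsRing_ball.
replace (pos eps) with (c * (eps / c)) by (field; lra). exact Hy.
Qed.

Lemma scalars_cauchy_limits (k : scalar_field) :
  has_cauchy_limits (AbsRing_UniformSpace (scalars k)).
Proof.
destruct k; [|exact complex_cauchy_limits].
intros F PF cF. exists (@lim R_CompleteNormedModule F).
exact (@complete_cauchy R_CompleteNormedModule F PF cF).
Qed.

(** Built on [AbsRing_NormedModule], whose norm is the modulus, rather than on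
    [C_CompleteNormedModule], so that the carrier is convertible to [scalars k]
    for a variable [k]. *)
Definition scalars_banach (k : scalar_field) : CompleteNormedModule (scalars k) :=
  CompleteNormedModule.Pack (scalars k) (scalars k)
    (CompleteNormedModule.Class (scalars k) (scalars k)
       (NormedModule.class (scalars k) (AbsRing_NormedModule (scalars k)))
       (cauchy_complete_mixin (scalars_cauchy_limits (k := k))))
    (scalars k).

Lemma scalars_abs_mult (k : scalar_field) (a b : scalars k) :
  abs (mult a b) = abs a * abs b.
Proof. destruct k; [exact (Rabs_mult a b) | exact (Cmod_mult a b)]. Qed.

Lemma scalars_abs_pos (k : scalar_field) (r : R) :
  0 < r -> exists a : scalars k, abs a = r.
Proof.
intros r0; destruct k.
- exists r. now apply Rabs_pos_eq, Rlt_le.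
- exists (RtoC r). change (Cmod (RtoC r) = r). rewrite Cmod_R.
  now apply Rabs_pos_eq, Rlt_le.
Qed.

Section BoundedFunctions.

Variables (K : AbsRing) (I : Type) (V : NormedModule K).

Definition bounded_fun : Type :=
  {f : I -> V | exists M : R, forall i, norm (f i) <= M}.

Definition bounded_apply (f : bounded_fun) : I -> V := proj1_sig f.
Coercion bounded_apply : bounded_fun >-> Funclass.

Lemma bounded_fun_eq (f g : bounded_fun) : (forall i, f i = g i) -> f = g.
Proof.
destruct f as [f Hf], g as [g Hg]; simpl; intros H.
apply functional_extensionality in H; subst g. f_equal; apply proof_irrelevance.
Qed.

Lemma bounded_plus_subproof (f g : bounded_fun) :
  exists M : R, forall i, norm (plus (f i) (g i)) <= M.
Proof.
destruct f as [f [M HM]], g as [g [N HN]]; simpl. exists (M + N); intros i.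
eapply Rle_trans; [apply norm_triangle|]. now apply Rplus_le_compat.
Qed.

Lemma bounded_opp_subproof (f : bounded_fun) :
  exists M : R, forall i, norm (opp (f i)) <= M.
Proof.
destruct f as [f [M HM]]; simpl. exists M; intros i. now rewrite norm_opp.
Qed.

Lemma bounded_zero_subproof :
  exists M : R, forall i : I, norm ((fun _ => zero : V) i) <= M.
Proof. exists 0; intros i. rewrite norm_zero. apply Rle_refl. Qed.

Lemma bounded_scal_subproof (a : K) (f : bounded_fun) :
  exists M : R, forall i, norm (scal a (f i)) <= M.
Proof.
destruct f as [f [M HM]]; simpl. exists (abs a * M); intros i.
eapply Rle_trans; [apply norm_scal|].
apply Rmult_le_compat_l; [apply abs_ge_0 | trivial].
Qed.

Definition bounded_plus (f g : bounded_fun) : bounded_fun :=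
  exist _ (fun i => plus (f i) (g i)) (bounded_plus_subproof f g).
Definition bounded_opp (f : bounded_fun) : bounded_fun :=
  exist _ (fun i => opp (f i)) (bounded_opp_subproof f).
Definition bounded_zero : bounded_fun :=
  exist _ (fun _ => zero) bounded_zero_subproof.
Definition bounded_scal (a : K) (f : bounded_fun) : bounded_fun :=
  exist _ (fun i => scal a (f i)) (bounded_scal_subproof a f).

Definition bounded_norm (f : bounded_fun) : R :=
  supR (fun r => exists i, r = norm (f i)).

Lemma bounded_norm_ge (f : bounded_fun) (i : I) : norm (f i) <= bounded_norm f.
Proof.
destruct (proj2_sig f) as [M HM]. apply supR_ge with M; [|now exists i].
intros s [j ->]; apply HM.
Qed.

Lemma bounded_norm_le (f : bounded_fun) (M : R) :
  0 <= M -> (forall i, norm (f i) <= M) -> bounded_norm f <= M.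
Proof. intros M0 HM. apply supR_le; trivial. intros s [i ->]; apply HM. Qed.

Lemma bounded_norm_ge0 (f : bounded_fun) : 0 <= bounded_norm f.
Proof.
destruct (proj2_sig f) as [M HM]. apply supR_ge0 with M.
intros s [i ->]. split; [apply norm_ge_0 | apply HM].
Qed.

Definition bounded_AbelianMonoid_mixin : AbelianMonoid.mixin_of bounded_fun.
Proof.
apply (AbelianMonoid.Mixin _ bounded_plus bounded_zero);
  intros; apply bounded_fun_eq; intros i; simpl.
apply plus_comm. apply plus_assoc. apply plus_zero_r.
Defined.

Definition bounded_AbelianMonoid :=
  AbelianMonoid.Pack bounded_fun bounded_AbelianMonoid_mixin bounded_fun.

Definition bounded_AbelianGroup_mixin : AbelianGroup.mixin_of bounded_AbelianMonoid.
Proof.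
apply (AbelianGroup.Mixin bounded_AbelianMonoid bounded_opp).
intros; apply bounded_fun_eq; intros i. exact (plus_opp_r ((x : bounded_fun) i)).
Defined.

Definition bounded_AbelianGroup :=
  AbelianGroup.Pack bounded_fun
    (AbelianGroup.Class _ _ bounded_AbelianGroup_mixin) bounded_fun.

Definition bounded_ModuleSpace_mixin : ModuleSpace.mixin_of K bounded_AbelianGroup.
Proof.
apply (ModuleSpace.Mixin K bounded_AbelianGroup bounded_scal);
  intros; apply bounded_fun_eq; intros i.
- exact (scal_assoc x y ((u : bounded_fun) i)).
- exact (scal_one ((u : bounded_fun) i)).
- exact (scal_distr_l x ((u : bounded_fun) i) ((v : bounded_fun) i)).
- exact (scal_distr_r x y ((u : bounded_fun) i)).
Defined.

Definition bounded_ModuleSpace :=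
  ModuleSpace.Pack K bounded_fun
    (ModuleSpace.Class _ _ _ bounded_ModuleSpace_mixin) bounded_fun.

Definition bounded_ball (f : bounded_fun) (e : R) (g : bounded_fun) : Prop :=
  bounded_norm (bounded_plus g (bounded_opp f)) < e.

Lemma bounded_norm_zero : bounded_norm bounded_zero = 0.
Proof.
apply Rle_antisym; [|apply bounded_norm_ge0].
apply bounded_norm_le. apply Rle_refl.
intros i; simpl. rewrite norm_zero. apply Rle_refl.
Qed.

Lemma bounded_norm_triangle (f g : bounded_fun) :
  bounded_norm (bounded_plus f g) <= bounded_norm f + bounded_norm g.
Proof.
apply bounded_norm_le.
- apply Rplus_le_le_0_compat; apply bounded_norm_ge0.
- intros i; simpl. eapply Rle_trans; [apply norm_triangle|].
  apply Rplus_le_compat; apply bounded_norm_ge.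
Qed.

Lemma bounded_norm_opp (f : bounded_fun) : bounded_norm (bounded_opp f) = bounded_norm f.
Proof.
apply Rle_antisym; apply bounded_norm_le; try apply bounded_norm_ge0; intros i.
- simpl; rewrite norm_opp. apply bounded_norm_ge.
- rewrite <- norm_opp. exact (bounded_norm_ge (bounded_opp f) i).
Qed.

Definition bounded_UniformSpace_mixin : UniformSpace.mixin_of bounded_fun.
Proof.
apply (UniformSpace.Mixin _ bounded_zero bounded_ball); unfold bounded_ball.
- intros f e. replace (bounded_plus f (bounded_opp f)) with bounded_zero.
  rewrite bounded_norm_zero. apply cond_pos.
  symmetry; apply bounded_fun_eq; intros i. exact (plus_opp_r (f i)).
- intros f g e. replace (bounded_plus f (bounded_opp g))
    with (bounded_opp (bounded_plus g (bounded_opp f))).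
  now rewrite bounded_norm_opp.
  apply bounded_fun_eq; intros i. exact (opp_minus (g i) (f i)).
- intros f g h e1 e2 H1 H2.
  replace (bounded_plus h (bounded_opp f)) with
    (bounded_plus (bounded_plus h (bounded_opp g)) (bounded_plus g (bounded_opp f))).
  eapply Rle_lt_trans; [apply bounded_norm_triangle|].
  rewrite Rplus_comm. now apply Rplus_lt_compat.
  apply bounded_fun_eq; intros i. symmetry. exact (minus_trans (g i) (h i) (f i)).
Defined.

Definition bounded_NormedModuleAux :=
  NormedModuleAux.Pack K bounded_fun
    (NormedModuleAux.Class K bounded_fun
       (ModuleSpace.class K bounded_ModuleSpace) bounded_UniformSpace_mixin)
    bounded_fun.

Definition bounded_NormedModule_mixin : NormedModule.mixin_of K bounded_NormedModuleAux.
Proof.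
apply (NormedModule.Mixin K bounded_NormedModuleAux bounded_norm 1).
- exact bounded_norm_triangle.
- intros a f. apply bounded_norm_le.
  + apply Rmult_le_pos; [apply abs_ge_0 | apply bounded_norm_ge0].
  + intros i. eapply Rle_trans; [apply (norm_scal a ((f : bounded_fun) i))|].
    apply Rmult_le_compat_l; [apply abs_ge_0 | apply bounded_norm_ge].
- intros f g eps H. exact H.
- intros f g eps H. rewrite Rmult_1_l. exact H.
- intros f H. apply bounded_fun_eq; intros i. apply norm_eq_zero.
  apply Rle_antisym; [|apply norm_ge_0]. rewrite <- H. apply bounded_norm_ge.
Defined.

Definition bounded_NormedModule :=
  NormedModule.Pack K bounded_fun
    (NormedModule.Class K bounded_fun
       (NormedModuleAux.class K bounded_NormedModuleAux) bounded_NormedModule_mixin)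
    bounded_fun.

Variable V_complete : has_cauchy_limits V.

Lemma bounded_cauchy_limits :
  has_cauchy_limits (NormedModule.UniformSpace K bounded_NormedModule).
Proof.
intros F0 PF0 cF. pose (F := F0 : (bounded_fun -> Prop) -> Prop).
assert (PF : ProperFilter F) by exact PF0.
change (forall eps : posreal, exists f : bounded_fun, F (bounded_ball f eps)) in cF.
change (exists h : bounded_fun, forall eps : posreal, F (bounded_ball h eps)).
clearbody F; clear F0 PF0.
assert (FF : Filter F) by apply PF.
assert (lims : forall i, exists l : V, forall eps : posreal,
  F (fun f : bounded_fun => ball l eps (f i))).
{ intros i. set (G := filtermap (fun f : bounded_fun => f i) F).
  assert (PG : ProperFilter G) by (apply filtermap_proper_filter; trivial).
  apply (V_complete (F := G) PG).
  intros eps. destruct (cF eps) as [f Hf]. exists (f i).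
  apply (filter_imp (F := F)) with (2 := Hf). intros g Hg.
  apply (@norm_compat1 K V).
  eapply Rle_lt_trans; [|exact Hg].
  exact (bounded_norm_ge (bounded_plus g (bounded_opp f)) i). }
set (l := fun i => proj1_sig (constructive_indefinite_description _ (lims i))).
assert (Hl : forall i (eps : posreal), F (fun f : bounded_fun => ball (l i) eps (f i))).
{ intros i. exact (proj2_sig (constructive_indefinite_description _ (lims i))). }
assert (near : forall (d : posreal) (f : bounded_fun), F (bounded_ball f d) ->
  forall i, norm (minus (l i) (f i)) <= d).
{ intros d f Hf i. apply le_epsilon; intros e e0.
  set (c := @norm_factor K V).
  assert (c0 : 0 < c) by apply norm_factor_gt_0.
  assert (ec : 0 < e / c) by (apply Rdiv_lt_0_compat; trivial).
  destruct (filter_ex (F := F) _ (filter_and _ _ Hf (Hl i (mkposreal _ ec))))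
    as [g [Hg1 Hg2]].
  apply (@norm_compat2 K V) in Hg2. fold c in Hg2; simpl in Hg2.
  replace (c * (e / c)) with e in Hg2 by (field; lra).
  assert (Hg3 := bounded_norm_ge (bounded_plus g (bounded_opp f)) i).
  unfold bounded_ball in Hg1. simpl in Hg3.
  rewrite (minus_trans (g i) (l i) (f i)).
  eapply Rle_trans; [apply norm_triangle|].
  rewrite <- (opp_minus (g i)), norm_opp.
  change (norm (minus (g i) (f i)) <=
    bounded_norm (bounded_plus g (bounded_opp f))) in Hg3.
  lra. }
assert (bl : exists M : R, forall i, norm (l i) <= M).
{ destruct (cF (mkposreal 1 Rlt_0_1)) as [f Hf].
  exists (1 + bounded_norm f). intros i.
  replace (l i) with (plus (minus (l i) (f i)) (f i)).
  eapply Rle_trans; [apply norm_triangle|].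
  apply Rplus_le_compat; [|apply bounded_norm_ge].
  apply (near (mkposreal 1 Rlt_0_1) f Hf i).
  unfold minus. now rewrite <- plus_assoc, plus_opp_l, plus_zero_r. }
exists (exist _ l bl : bounded_fun). intros eps.
assert (e3 : 0 < eps / 3) by (generalize (cond_pos eps); lra).
destruct (cF (mkposreal _ e3)) as [f Hf].
apply (filter_imp (F := F)) with (2 := Hf). intros g Hg.
change (bounded_norm (bounded_plus g (bounded_opp f)) < eps / 3) in Hg.
change (bounded_norm (bounded_plus g (bounded_opp (exist _ l bl))) < eps).
apply Rle_lt_trans with (eps / 3 + eps / 3); [|lra].
apply bounded_norm_le; [lra|]. intros i; simpl.
change (norm (minus (g i) (l i)) <= eps / 3 + eps / 3).
rewrite (minus_trans (f i) (g i) (l i)).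
eapply Rle_trans; [apply norm_triangle|]. apply Rplus_le_compat.
- apply Rlt_le; eapply Rle_lt_trans; [|exact Hg].
  exact (bounded_norm_ge (bounded_plus g (bounded_opp f)) i).
- rewrite <- (opp_minus (l i)), norm_opp. exact (near _ f Hf i).
Qed.

Definition bounded_CompleteNormedModule : CompleteNormedModule K :=
  CompleteNormedModule.Pack K bounded_fun
    (CompleteNormedModule.Class K bounded_fun
       (NormedModule.class K bounded_NormedModule)
       (cauchy_complete_mixin bounded_cauchy_limits))
    bounded_fun.

End BoundedFunctions.

Definition linfty (k : scalar_field) (I : Type) : CompleteNormedModule (scalars k) :=
  bounded_CompleteNormedModule I (scalars_cauchy_limits (k := k)).

Definition update (I : Type) (m : nat) (x : Fin.t m -> I) (i : Fin.t m) (u : I) :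
    Fin.t m -> I :=
  fun j => if Fin.eq_dec j i then u else x j.

Definition multilinear (K : AbsRing) (E F : NormedModule K) (m : nat)
    (A : (Fin.t m -> E) -> F) : Prop :=
  forall (x : Fin.t m -> E) (i : Fin.t m),
    (forall u v : E,
       A (update x i (plus u v)) = plus (A (update x i u)) (A (update x i v))) /\
    (forall (a : K) (u : E), A (update x i (scal a u)) = scal a (A (update x i u))).

Definition hom_polynomial (K : AbsRing) (E F : NormedModule K) (m : nat)
    (P : E -> F) : Prop :=
  (exists A : (Fin.t m -> E) -> F,
     multilinear A /\ forall x : E, P x = A (fun _ => x)) /\
  forall x : E, continuous P x.

(** For a bounded linear operator this is the operator norm. *)
Definition sup_norm (K : AbsRing) (E F : NormedModule K) (P : E -> F) : R :=
  supR (fun r => exists x : E, norm x <= 1 /\ r = norm (P x)).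

Definition finite_type (K : AbsRing) (E F : NormedModule K) (m : nat)
    (P : E -> F) : Prop :=
  exists (n : nat) (phi : nat -> E -> K) (y : nat -> F),
    (forall i, is_linear (phi i)) /\
    forall x : E, P x = sum_n (fun i => scal (pow_n (phi i x) m) (y i)) n.

Definition metric_injection (K : AbsRing) (F G : NormedModule K) (j : F -> G) : Prop :=
  is_linear j /\ forall y : F, norm (j y) = norm y.

Definition dual_ball (k : scalar_field) (F : NormedModule (scalars k)) : Type :=
  {phi : F -> scalars k | is_linear phi /\ sup_norm phi <= 1}.

Lemma dual_ball_bound (k : scalar_field) (F : NormedModule (scalars k))
    (y : F) (phi : dual_ball F) :
  norm (proj1_sig phi y) <= norm y.
Proof.
destruct phi as [phi [lin le1]]; simpl.
destruct (Rle_lt_or_eq_dec _ _ (norm_ge_0 y)) as [y0|y0].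
- destruct (@scalars_abs_pos k (/ norm y)) as [a Ha].
  now apply Rinv_0_lt_compat.
  destruct (linear_norm phi lin) as [M [M0 HM]].
  assert (H : norm (phi (scal a y)) <= sup_norm phi).
  { apply supR_ge with M.
    - intros s [x [Hx ->]]. eapply Rle_trans; [apply HM|].
      rewrite <- (Rmult_1_r M) at 2. apply Rmult_le_compat_l; [lra | trivial].
    - exists (scal a y); split; trivial.
      eapply Rle_trans; [apply norm_scal|]. rewrite Ha.
      right; apply Rinv_l; lra. }
  rewrite (linear_scal phi lin) in H.
  change (abs (mult a (phi y)) <= sup_norm phi) in H.
  rewrite scalars_abs_mult, Ha in H.
  change (abs (phi y) <= norm y).
  apply Rmult_le_reg_l with (/ norm y). now apply Rinv_0_lt_compat.
  rewrite Rinv_l; lra.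
- symmetry in y0. apply norm_eq_zero in y0; subst y.
  rewrite (linear_zero phi lin). rewrite !norm_zero. apply Rle_refl.
Qed.

Lemma canonical_injection_subproof (k : scalar_field)
    (F : NormedModule (scalars k)) (y : F) :
  exists M : R, forall phi : dual_ball F,
    norm (proj1_sig phi y) <= M.
Proof. exists (norm y). intros phi. exact (dual_ball_bound y phi). Qed.

Definition canonical_injection (k : scalar_field)
    (F : NormedModule (scalars k)) (y : F) : linfty k (dual_ball F) :=
  exist _ (fun phi : dual_ball F => proj1_sig phi y) (canonical_injection_subproof y).

Section Ideals.

Variable k : scalar_field.

Notation K := (scalars k).
Notation Banach := (CompleteNormedModule (scalars k)).

(** A class is not graded by the degree: its degree [m] component is cut out by
    [component]. Only the zero map lies in components of several degrees. *)
Definition poly_class : Type := forall E F : Banach, (E -> F) -> Prop.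

(** Only the values on members of the class matter. *)
Definition class_norm : Type := forall E F : Banach, (E -> F) -> R.

Implicit Types (Q : poly_class) (N : class_norm).

Definition component Q (m : nat) (E F : Banach) (P : E -> F) : Prop :=
  hom_polynomial m P /\ Q E F P.

(** Degrees range over the positive integers. *)
Record component_axioms Q : Prop := {
  class_polynomial : forall (E F : Banach) (P : E -> F),
    Q E F P -> exists m, (0 < m)%nat /\ hom_polynomial m P;
  component_finite_type : forall (m : nat) (E F : Banach) (P : E -> F),
    (0 < m)%nat -> finite_type m P -> component Q m P;
  component_plus : forall (m : nat) (E F : Banach) (P1 P2 : E -> F),
    (0 < m)%nat -> component Q m P1 -> component Q m P2 ->
    component Q m (fun x => plus (P1 x) (P2 x));
  component_scal : forall (m : nat) (E F : Banach) (a : K) (P : E -> F),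
    (0 < m)%nat -> component Q m P -> component Q m (fun x => scal a (P x))
}.

Record polynomial_ideal Q : Prop := {
  ideal_components : component_axioms Q;
  ideal_comp : forall (m : nat) (E F G H : Banach)
      (t : G -> H) (P : F -> G) (u : E -> F),
    (0 < m)%nat -> is_linear t -> component Q m P -> is_linear u ->
    component Q m (fun x => t (P (u x)))
}.

Record polynomial_hyper_ideal Q : Prop := {
  hyper_ideal_ideal : polynomial_ideal Q;
  hyper_ideal_comp : forall (m n : nat) (E F G H : Banach)
      (t : G -> H) (P : F -> G) (S : E -> F),
    (0 < m)%nat -> (0 < n)%nat ->
    is_linear t -> component Q m P -> hom_polynomial n S ->
    component Q (m * n) (fun x => t (P (S x)))
}.

Record norm_axioms Q N : Prop := {
  class_norm_ge0 : forall (m : nat) (E F : Banach) (P : E -> F),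
    (0 < m)%nat -> component Q m P -> 0 <= N E F P;
  class_norm_eq0 : forall (m : nat) (E F : Banach) (P : E -> F),
    (0 < m)%nat -> component Q m P -> N E F P = 0 -> forall x, P x = zero;
  class_norm_scal : forall (m : nat) (E F : Banach) (a : K) (P : E -> F),
    (0 < m)%nat -> component Q m P ->
    N E F (fun x => scal a (P x)) = abs a * N E F P;
  class_norm_triangle : forall (m : nat) (E F : Banach) (P1 P2 : E -> F),
    (0 < m)%nat -> component Q m P1 -> component Q m P2 ->
    N E F (fun x => plus (P1 x) (P2 x)) <= N E F P1 + N E F P2;
  class_norm_power : forall m : nat, (0 < m)%nat ->
    N (scalars_banach k) (scalars_banach k) (fun l : K => pow_n l m) = 1
}.

Record normed_polynomial_ideal Q N : Prop := {
  normed_ideal_ideal : polynomial_ideal Q;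
  normed_ideal_norm : norm_axioms Q N;
  normed_ideal_comp : forall (m : nat) (E F G H : Banach)
      (t : G -> H) (P : F -> G) (u : E -> F),
    (0 < m)%nat -> is_linear t -> component Q m P -> is_linear u ->
    N E H (fun x => t (P (u x))) <= sup_norm t * N F G P * sup_norm u ^ m
}.

Record normed_polynomial_hyper_ideal Q N : Prop := {
  normed_hyper_ideal_hyper_ideal : polynomial_hyper_ideal Q;
  normed_hyper_ideal_norm : norm_axioms Q N;
  normed_hyper_ideal_comp : forall (m n : nat) (E F G H : Banach)
      (t : G -> H) (P : F -> G) (S : E -> F),
    (0 < m)%nat -> (0 < n)%nat ->
    is_linear t -> component Q m P -> hom_polynomial n S ->
    N E H (fun x => t (P (S x))) <= sup_norm t * N F G P * sup_norm S ^ m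
}.

Definition complete_components Q N : Prop :=
  forall (m : nat) (E F : Banach) (P : nat -> E -> F),
    (0 < m)%nat -> (forall n, component Q m (P n)) ->
    (forall eps : R, 0 < eps -> exists n0 : nat, forall p q : nat,
       (n0 <= p)%nat -> (n0 <= q)%nat ->
       N E F (fun x => minus (P p x) (P q x)) < eps) ->
    exists P0 : E -> F, component Q m P0 /\
      is_lim_seq (fun n => N E F (fun x => minus (P n x) (P0 x))) 0.

Definition banach_polynomial_ideal Q N : Prop :=
  normed_polynomial_ideal Q N /\ complete_components Q N.

Definition banach_polynomial_hyper_ideal Q N : Prop :=
  normed_polynomial_hyper_ideal Q N /\ complete_components Q N.

Definition injective_class Q : Prop :=
  forall (m : nat) (E F G : Banach) (P : E -> F) (j : F -> G),
    (0 < m)%nat -> hom_polynomial m P -> metric_injection j ->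
    component Q m (fun x => j (P x)) -> component Q m P.

Definition injective_normed_class Q N : Prop :=
  injective_class Q /\
  forall (m : nat) (E F G : Banach) (P : E -> F) (j : F -> G),
    (0 < m)%nat -> hom_polynomial m P -> metric_injection j ->
    component Q m (fun x => j (P x)) -> N E F P = N E G (fun x => j (P x)).

(** The union over the degrees of the components of the hull. *)
Definition injective_hull Q : poly_class := fun E F P =>
  exists m : nat, (0 < m)%nat /\ hom_polynomial m P /\
    component Q m (fun x => canonical_injection (P x)).

Definition injective_hull_norm N : class_norm := fun E F P =>
  N E (linfty k (dual_ball F)) (fun x => canonical_injection (P x)).

Definition same_class Q1 Q2 : Prop :=
  forall (E F : Banach) (P : E -> F), Q1 E F P <-> Q2 E F P.

Definition same_norm_on Q N1 N2 : Prop :=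
  forall (E F : Banach) (P : E -> F), Q E F P -> N1 E F P = N2 E F P.

End Ideals.

(* Main.v *)
(** Injective ideals coincide with their hull because [linfty] is an injective
    object: applying Hahn-Banach coordinatewise, [canonical_injection] on [F]
    extends along any metric injection [j : F -> G] to a linear contraction [t]
    on [G], so that [I_F o P = t o (j o P)] and the ideal property bounds the
    hull of [P] by [j o P]. Hahn-Banach also makes [canonical_injection] itself
    a metric injection, so injectivity can be applied to it. *)

Require Import Defs.
From Stdlib Require Import Reals Lra Classical ClassicalEpsilon.
From Coquelicot Require Import Coquelicot.
From mathcomp Require boolp classical_sets.

Set Implicit Arguments.
Unset Strict Implicit.
Unset Printing Implicit Defensive.

Open Scope R_scope.

(** * Partial linear maps and Zorn's lemma *)

(** A linear map on a subspace, encoded by its graph: extension is inclusion, and the bound of a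
    chain is its union. Single-valuedness is obtained from domination, in [dominated_unique]. *)
Record linear_relation (K : Ring) (V W : ModuleSpace K) (A : V -> W -> Prop) : Prop := {
  relation_zero : A zero zero;
  relation_plus : forall x y r s, A x r -> A y s -> A (plus x y) (plus r s);
  relation_scal : forall a x r, A x r -> A (scal a x) (scal a r)
}.

(** Zorn's lemma is applied to the good relations above [A0]. Using inclusion as a mere preorder
    avoids comparing the proofs carried by elements of the subtype [T]. *)
Lemma zorn_relation (V W : Type) (good : (V -> W -> Prop) -> Prop) (A0 : V -> W -> Prop) :
  good A0 ->
  (forall C : (V -> W -> Prop) -> Prop,
     (exists A, C A) -> (forall A, C A -> good A) ->
     (forall A B, C A -> C B ->
        (forall x r, A x r -> B x r) \/ (forall x r, B x r -> A x r)) ->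
     good (fun x r => exists A, C A /\ A x r)) ->
  exists A, good A /\ (forall x r, A0 x r -> A x r) /\
    forall B, good B -> (forall x r, A x r -> B x r) -> forall x r, B x r -> A x r.
Proof.
intros good0 chains.
pose (above := fun A : V -> W -> Prop => good A /\ forall x r, A0 x r -> A x r).
pose (T := {A | above A}).
pose (le := fun A B : T => boolp.asbool (forall x r, proj1_sig A x r -> proj1_sig B x r)).
assert (leP : forall A B, is_true (le A B) <->
  forall x r, proj1_sig A x r -> proj1_sig B x r).
{ intros A B. split; [exact (@boolp.asboolW _) | exact (@boolp.asboolT _)]. }
assert (t0 : T) by (exists A0; split; trivial).
destruct (@classical_sets.ZL_preorder T t0 le) as [[A [gA A0A]] maxA].
- intros A. apply leP; trivial.
- intros A B C AB BC. rewrite leP in *. auto.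
- intros C Ctot. destruct (classic (exists A, C A)) as [[[A [gA A0A]] CA]|none].
  + set (C' := fun A => exists H, C (exist _ A H)).
    assert (gU : good (fun x r => exists A, C' A /\ A x r)).
    { apply chains.
      - exists A, (conj gA A0A). exact CA.
      - intros B [[gB _] _]; exact gB.
      - intros B1 B2 [H1 C1] [H2 C2]. destruct (Ctot _ _ C1 C2) as [H|H];
          rewrite leP in H; auto. }
    assert (A0U : forall x r, A0 x r -> exists A, C' A /\ A x r).
    { intros x r Hx. exists A. split; [|auto].
      exists (conj gA A0A). exact CA. }
    exists (exist above _ (conj gU A0U)). intros [B HB] CB. apply leP; simpl.
    intros x r Hx. exists B. split; [now exists HB | exact Hx].
  (* The hypothesis on chains speaks of nonempty ones; the empty chain is bounded by [A0] itself. *)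
  + exists t0. intros B CB. destruct none; now exists B.
- exists A. split; [exact gA|]. split; [exact A0A|]. intros B gB AB.
  assert (H : is_true
    (le (exist above A (conj gA A0A))
        (exist above B (conj gB (fun x r H => AB x r (A0A x r H)))))) by now apply leP.
  apply maxA in H. now rewrite leP in H.
Qed.

Lemma plus_opp_cancel (G : AbelianGroup) (x y z : G) :
  plus (plus x (opp z)) (plus y z) = plus x y.
Proof.
rewrite (plus_comm y z), <- plus_assoc, (plus_assoc (opp z)).
now rewrite plus_opp_l, plus_zero_l.
Qed.

(** * Real Hahn-Banach theorem for a sublinear bound *)

Section RealHahnBanach.

Variables (V : ModuleSpace R_Ring) (p : V -> R).
Hypothesis p_plus : forall x y, p (plus x y) <= p x + p y.
Hypothesis p_scal : forall a x, 0 < a -> p (scal a x) <= a * p x.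

Definition dominated (A : V -> R -> Prop) : Prop :=
  @linear_relation R_Ring V (Ring_ModuleSpace R_Ring) A /\ forall x r, A x r -> r <= p x.

Lemma dominated_union (C : (V -> R -> Prop) -> Prop) :
  (exists A, C A) -> (forall A, C A -> dominated A) ->
  (forall A B, C A -> C B ->
     (forall x r, A x r -> B x r) \/ (forall x r, B x r -> A x r)) ->
  dominated (fun x r => exists A, C A /\ A x r).
Proof.
intros [A0 CA0] dom tot. split; [split|].
- exists A0. split; trivial. apply (dom A0 CA0).
- intros x y r s [A [CA Ax]] [B [CB By]].
  destruct (tot A B CA CB) as [H|H]; [exists B | exists A]; split; trivial.
  + now apply (relation_plus (proj1 (dom B CB))); [apply H|].
  + now apply (relation_plus (proj1 (dom A CA))); [|apply H].
- intros a x r [A [CA Ax]]. exists A. split; trivial.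
  now apply (relation_scal (proj1 (dom A CA))).
- intros x r [A [CA Ax]]. now apply (dom A CA).
Qed.

(** Subtracting the two pairs puts [r - s] and [s - r] over the zero vector, where [p] is at most
    0. *)
Lemma dominated_unique (A : V -> R -> Prop) (x : V) (r s : R) :
  dominated A -> A x r -> A x s -> r = s.
Proof.
intros [lin dom] Hr Hs.
assert (p0 : p zero <= 0).
(* Scaling the zero vector by one half gives [p zero <= p zero / 2]. *)
{ assert (H := @p_scal (/ 2) zero ltac:(lra)). rewrite scal_zero_r in H. lra. }
assert (diff : forall r s, A x r -> A x s -> r <= s).
{ clear r s Hr Hs; intros r s Hr Hs.
  assert (H := relation_plus lin Hr (relation_scal lin (opp one) Hs)).
  apply dom in H. rewrite (scal_opp_one x), (plus_opp_r x : plus x (opp x) = zero) in H.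
  change (r + (-1) * s <= p zero) in H. lra. }
apply Rle_antisym; auto.
Qed.

(** The one-dimensional extension step: [x0] receives a value [c] with
    [s - p (y - x0) <= c <= p (z + x0) - t] for all pairs [(y, s)] and [(z, t)] of [A]. The
    construction also covers an [x0] already in the domain. *)
Lemma dominated_extend (A : V -> R -> Prop) (x0 : V) :
  dominated A -> exists B, dominated B /\ (forall x r, A x r -> B x r) /\
    exists c, B x0 c.
Proof.
intros [lin dom].
set (S := fun q => exists y s, A y s /\ q = s - p (plus y (opp x0))).
(* Lower and upper constraints are compatible because [s + t <= p (y + z) <= p (y - x0) + p (z +
   x0)]; [c] is then the supremum of the lower ones. *)
assert (SU : forall z t, A z t -> is_upper_bound S (p (plus z x0) - t)).
{ intros z t Hz q [y [s [Hy ->]]].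
  assert (H1 := dom _ _ (relation_plus lin Hy Hz)). change (s + t <= p (plus y z)) in H1.
  assert (H2 := p_plus (plus y (opp x0)) (plus z x0)).
  replace (plus (plus y (opp x0)) (plus z x0)) with (plus y z) in H2; [lra|].
  symmetry. exact (plus_opp_cancel y z x0). }
assert (A0 := relation_zero lin).
destruct (@completeness S) as [c [ub least]].
{ eexists. exact (SU _ _ A0). }
{ eexists. exists zero, 0. split; [exact A0 | reflexivity]. }
assert (above : forall y s, A y s -> s - p (plus y (opp x0)) <= c).
{ intros y s Hy. apply ub. now exists y, s. }
assert (below : forall y s, A y s -> c <= p (plus y x0) - s).
{ intros y s Hy. apply least. now apply SU. }
exists (fun x r => exists y s t, A y s /\ x = plus y (scal t x0) /\ r = s + t * c).
split; [split; [split|]|split].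
- exists zero, 0, 0. repeat split.
  + exact A0.
  + now rewrite (scal_zero_l x0 : scal 0 x0 = zero), plus_zero_r.
  + change (0 = 0 + 0 * c). ring.
- intros x1 x2 r1 r2 [y1 [s1 [t1 [H1 [-> ->]]]]] [y2 [s2 [t2 [H2 [-> ->]]]]].
  exists (plus y1 y2), (s1 + s2), (t1 + t2). repeat split.
  + exact (relation_plus lin H1 H2).
  + change (t1 + t2) with (plus t1 t2). rewrite (@scal_distr_r R_Ring).
    rewrite <- !plus_assoc. f_equal. rewrite !plus_assoc. f_equal. apply plus_comm.
  + change ((s1 + t1 * c) + (s2 + t2 * c) = s1 + s2 + (t1 + t2) * c). ring.
- intros a x r [y [s [t [H [-> ->]]]]].
  exists (scal a y), (a * s), (a * t). repeat split.
  + exact (relation_scal lin a H).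
  + rewrite scal_distr_l. f_equal. exact (scal_assoc a t x0).
  + change (a * (s + t * c) = a * s + a * t * c). ring.
(* Domination of [s + t * c]: for [t < 0] the lower constraint is used at [y / (- t)], for [t > 0]
   the upper one at [y / t]. Multiplying back by the modulus of [t] is the purpose of [descale]. *)
- intros x r [y [s [t [H [-> ->]]]]].
  assert (descale : forall a v, 0 < a -> a * p (scal (/ a) v) <= p v).
  { intros a v a0. assert (H' := @p_scal (/ a) v ltac:(now apply Rinv_0_lt_compat)).
    apply Rmult_le_compat_l with (r := a) in H'; [|lra].
    rewrite <- Rmult_assoc, Rinv_r, Rmult_1_l in H'; lra. }
  destruct (Rtotal_order t 0) as [neg|[->|pos]].
  + assert (H1 := above _ _ (relation_scal lin (/ - t) H)).
    change (/ - t * s - p (plus (scal (/ - t) y) (opp x0)) <= c) in H1.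
    assert (H2 := @descale (- t) (plus y (scal t x0)) ltac:(lra)).
    rewrite scal_distr_l, (@scal_assoc R_Ring) in H2.
    replace (@mult R_Ring (/ - t) t) with (@opp R_Ring one) in H2
      by (change (- (1) = / - t * t); field; lra).
    rewrite (@scal_opp_one R_Ring) in H2.
    apply Rmult_le_compat_l with (r := - t) in H1; [|lra].
    rewrite Rmult_minus_distr_l, <- Rmult_assoc, Rinv_r, Rmult_1_l in H1; lra.
  + rewrite (scal_zero_l x0 : scal 0 x0 = zero), plus_zero_r.
    assert (H1 := dom _ _ H). lra.
  + assert (H1 := below _ _ (relation_scal lin (/ t) H)).
    change (c <= p (plus (scal (/ t) y) x0) - / t * s) in H1.
    assert (H2 := @descale t (plus y (scal t x0)) pos).
    rewrite scal_distr_l, (@scal_assoc R_Ring) in H2.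
    replace (@mult R_Ring (/ t) t) with (@one R_Ring) in H2
      by (change (1 = / t * t); field; lra).
    rewrite (@scal_one R_Ring) in H2.
    apply Rmult_le_compat_l with (r := t) in H1; [|lra].
    rewrite Rmult_minus_distr_l, <- Rmult_assoc, Rinv_r, Rmult_1_l in H1; lra.
- intros x r Hx. exists x, r, 0. repeat split; trivial.
  + now rewrite (scal_zero_l x0 : scal 0 x0 = zero), plus_zero_r.
  + ring.
- exists c, zero, 0, 1. repeat split.
  + exact A0.
  + now rewrite plus_zero_l, (scal_one x0 : scal 1 x0 = x0).
  + ring.
Qed.

(** A maximal dominated extension has full domain, since [dominated_extend] would otherwise enlarge
    it; being single-valued, it is the graph of [g]. *)
Lemma hahn_banach_real (A : V -> R -> Prop) :
  dominated A ->
  exists g : V -> R,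
    (forall x y, g (plus x y) = g x + g y) /\
    (forall a x, g (scal a x) = a * g x) /\
    (forall x, g x <= p x) /\
    (forall x r, A x r -> g x = r).
Proof.
intros domA.
destruct (zorn_relation domA dominated_union) as [M [domM [AM maxM]]].
assert (total : forall x, exists r, M x r).
{ intros x. destruct (@dominated_extend M x domM) as [B [domB [MB [c Bc]]]].
  exists c. exact (maxM B domB MB x c Bc). }
set (g := fun x => proj1_sig (constructive_indefinite_description _ (total x))).
assert (Mg : forall x, M x (g x)).
{ intros x. exact (proj2_sig (constructive_indefinite_description _ (total x))). }
assert (gE : forall x r, M x r -> g x = r).
{ intros x r H. exact (dominated_unique domM (Mg x) H). }
exists g. repeat split.
- intros x y. apply gE. exact (relation_plus (proj1 domM) (Mg x) (Mg y)).
- intros a x. apply gE. exact (relation_scal (proj1 domM) a (Mg x)).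
- intros x. apply (proj2 domM), Mg.
- intros x r H. apply gE, AM, H.
Qed.

End RealHahnBanach.

(** * Hahn-Banach for real and complex normed spaces *)

Section RealRestriction.

Variable V : ModuleSpace C_Ring.

Definition real_restriction_mixin : ModuleSpace.mixin_of R_Ring (ModuleSpace.AbelianGroup _ V).
Proof.
apply (ModuleSpace.Mixin R_Ring _ (fun a (x : V) => scal (RtoC a) x)).
- intros a b x. rewrite (@scal_assoc C_Ring). f_equal. symmetry. exact (RtoC_mult a b).
- intros x. exact (scal_one x).
- intros a x y. exact (scal_distr_l (RtoC a) x y).
- intros a b x. eapply eq_trans; [|exact (scal_distr_r (RtoC a) (RtoC b) x)].
  apply (f_equal (fun c => scal c x)). exact (RtoC_plus a b).
Defined.

(** Carrier and addition stay those of [V], so the norm of [V] serves directly as the sublinear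
    bound. *)
Definition real_restriction : ModuleSpace R_Ring :=
  ModuleSpace.Pack R_Ring V (ModuleSpace.Class _ _ _ real_restriction_mixin) V.

End RealRestriction.

(** The sublinear bound is the norm; evaluating [g] at the opposite vector turns the one-sided bound
    into one on the absolute value. *)
Lemma hahn_banach_real_scalars (V : NormedModule R_AbsRing) (A : V -> R -> Prop) :
  @linear_relation R_Ring V (Ring_ModuleSpace R_Ring) A ->
  (forall x r, A x r -> Rabs r <= norm x) ->
  exists f : V -> R, @is_linear R_AbsRing V (AbsRing_NormedModule R_AbsRing) f /\
    (forall x, Rabs (f x) <= norm x) /\ forall x r, A x r -> f x = r.
Proof.
intros lin dom.
destruct (@hahn_banach_real V norm norm_triangle) with (A := A)
  as [g [gplus [gscal [gle gA]]]].
- intros a x a0. rewrite <- (Rabs_pos_eq a) at 2 by lra.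
  exact (@norm_scal R_AbsRing V a x).
- split; trivial. intros x r H. eapply Rle_trans; [apply Rle_abs|]. now apply dom.
- assert (gabs : forall x, Rabs (g x) <= norm x).
  { intros x. apply Rabs_le. split; [|apply gle].
    assert (H := gle (scal (opp one) x)). rewrite gscal in H.
    rewrite (eq_trans (f_equal norm (scal_opp_one x)) (norm_opp x)
      : norm (scal (opp one) x) = norm x) in H.
    change (- (1) * g x <= norm x) in H. lra. }
  exists g. split; [split|split]; trivial.
  exists 1. split; [lra|]. intros x. rewrite Rmult_1_l. exact (gabs x).
Qed.

(** The Bohnenblust-Sobczyk reduction: a complex functional [f] is recovered from
    [g = Re f] as [f x = g x - i g (i x)]. *)
Lemma hahn_banach_complex_scalars (V : NormedModule C_AbsRing) (A : V -> C -> Prop) :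
  @linear_relation C_Ring V (Ring_ModuleSpace C_Ring) A ->
  (forall x r, A x r -> Cmod r <= norm x) ->
  exists f : V -> C, @is_linear C_AbsRing V (AbsRing_NormedModule C_AbsRing) f /\
    (forall x, Cmod (f x) <= norm x) /\ forall x r, A x r -> f x = r.
Proof.
intros lin dom.
destruct (@hahn_banach_real (real_restriction V) norm norm_triangle)
  (* The relation to be extended consists of the real parts of the values of [A]. *)
  with (A := fun x r => exists z, A x z /\ r = fst z)
  as [g [gplus [gscal [gle gA]]]].
- intros a x a0. rewrite <- (Rabs_pos_eq a) at 2 by lra. rewrite <- Cmod_R.
  exact (@norm_scal C_AbsRing V (RtoC a) x).
- split; [split|].
  + exists (RtoC 0). split; trivial. exact (relation_zero lin).
  + intros x y r s [z [Hz ->]] [w [Hw ->]]. exists (Cplus z w). split; trivial.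
    exact (relation_plus lin Hz Hw).
  + intros a x r [z [Hz ->]]. exists (Cmult (RtoC a) z). split.
    exact (relation_scal lin (RtoC a) Hz).
    change (a * fst z = a * fst z - 0 * snd z). ring.
  + intros x r [z [Hz ->]]. eapply Rle_trans; [apply Rle_abs|].
    eapply Rle_trans; [|exact (dom _ _ Hz)].
    eapply Rle_trans; [apply Rmax_l | apply Rmax_Cmod].
- change (forall x y : V, g (plus x y) = g x + g y) in gplus.
  change (forall a (x : V), g (scal (RtoC a) x) = a * g x) in gscal.
  set (f := fun x : V => (g x, - g (scal Ci x)) : C).
  assert (fplus : forall x y, f (plus x y) = Cplus (f x) (f y)).
  { intros x y. unfold f.
    rewrite (scal_distr_l Ci x y : scal Ci (plus x y) = plus (scal Ci x) (scal Ci y)), !gplus. unfold Cplus; simpl.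
    f_equal; ring. }
  (* Real linearity of [g] along [a = Re a + i Im a]; complex homogeneity of [f] follows from it by
     computation. *)
  assert (gC : forall (a : C) x, g (scal a x) = fst a * g x + snd a * g (scal Ci x)).
  { intros [a b] x. rewrite <- !gscal, <- gplus. f_equal.
    rewrite (@scal_assoc C_Ring).
    eapply eq_trans; [|exact (scal_distr_r (RtoC a) (mult (RtoC b) Ci) x)].
    apply (f_equal (fun c => scal c x)).
    change ((a, b) = Cplus (RtoC a) (Cmult (RtoC b) Ci)).
    unfold Cplus, Cmult, RtoC, Ci; simpl. f_equal; ring. }
  assert (fscal : forall (a : C) x, f (scal a x) = Cmult a (f x)).
  { intros a x. unfold f.
    rewrite (scal_assoc Ci a x : _ = scal (Cmult Ci a) x), (gC a x), (gC (Cmult Ci a) x).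
    destruct a as [a b]. unfold Cmult; simpl. f_equal; ring. }
  assert (fabs : forall x, Cmod (f x) <= norm x).
  { intros x. destruct (Req_dec (Cmod (f x)) 0) as [H|H].
    { rewrite H. apply norm_ge_0. }
    assert (f0 : f x <> 0) by (intros E; now apply H; rewrite E, Cmod_0).
    (* A unimodular factor rotates [f x] onto its modulus, so that [Cmod (f x) = g (a x)], which the
       norm bounds. *)
    set (a := Cdiv (RtoC (Cmod (f x))) (f x)).
    assert (a1 : Cmod a = 1).
    { unfold a. rewrite Cmod_div, Cmod_R, Rabs_pos_eq by
        (trivial; apply Cmod_ge_0). now field. }
    assert (E : f (scal a x) = RtoC (Cmod (f x))).
    { rewrite fscal. unfold a. now field. }
    apply (f_equal fst) in E. simpl in E. rewrite <- E.
    eapply Rle_trans; [apply gle|]. rewrite <- (Rmult_1_l (norm x)), <- a1.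
    apply (@norm_scal C_AbsRing V). }
  exists f. split; [split|split]; trivial.
  + exists 1. split; [lra|]. intros x. rewrite Rmult_1_l. exact (fabs x).
  + intros x z Hz. unfold f.
    rewrite (gA x (fst z)) by now exists z.
    (* The pair [(i x, i z)] also lies in [A], and [- Re (i z) = Im z] recovers the imaginary
       part. *)
    assert (Hi := relation_scal lin Ci Hz).
    rewrite (gA (scal Ci x) (fst (Cmult Ci z))) by (eexists; split; [exact Hi|reflexivity]).
    destruct z as [a b]; simpl. f_equal; ring.
Qed.

(** * Extension of functionals and norming functionals *)

Section Scalars.

Variable k : scalar_field.
Notation K := (scalars k).

Lemma hahn_banach (V : NormedModule K) (A : V -> K -> Prop) :
  @linear_relation K V (AbsRing_NormedModule K) A ->
  (forall x r, A x r -> abs r <= norm x) ->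
  exists f : V -> K, is_linear f /\
    (forall x, abs (f x) <= norm x) /\ forall x r, A x r -> f x = r.
Proof.
clear. destruct k.
- exact (@hahn_banach_real_scalars V A).
- exact (@hahn_banach_complex_scalars V A).
Qed.

(** Hahn-Banach is applied to the relation of all pairs [(j y, phi y)] on the image of [j]; it is
    bounded by the norm because [j] is isometric. *)
Lemma functional_extension (F G : NormedModule K) (j : F -> G) (phi : F -> K) :
  metric_injection j -> is_linear phi -> (forall y, norm (phi y) <= norm y) ->
  exists psi : G -> K, is_linear psi /\ (forall z, norm (psi z) <= norm z) /\
    forall y, psi (j y) = phi y.
Proof.
intros [lin iso] linphi phile.
destruct (@hahn_banach G (fun z r => exists y, z = j y /\ r = phi y))
  as [psi [H1 [H2 H3]]].
- split.
  + exists zero. now rewrite (linear_zero j lin), (linear_zero phi linphi).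
  + intros x y r s [x' [-> ->]] [y' [-> ->]]. exists (plus x' y').
    now rewrite (linear_plus j lin), (linear_plus phi linphi).
  + intros a x r [x' [-> ->]]. exists (scal a x').
    now rewrite (linear_scal j lin), (linear_scal phi linphi).
- intros z r [y [-> ->]]. rewrite iso. apply phile.
- exists psi. split; [|split]; trivial. intros y. apply H3. now exists y.
Qed.

Lemma scalars_inverse (a : K) : 0 < abs a -> exists b : K, mult b a = one.
Proof.
clear. destruct k; simpl; intros a0.
- exists (/ a). apply Rinv_l. intros ->. change (0 < Rabs 0) in a0.
  rewrite Rabs_R0 in a0. lra.
- exists (Cinv a). apply Cinv_l. intros ->. change (0 < Cmod 0) in a0.
  rewrite Cmod_0 in a0. lra.
Qed.

(** The reverse of [norm_scal] comes from scaling back by an inverse [b] of [a], with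
    [abs b * abs a = 1]. *)
Lemma norm_scal_eq (V : NormedModule K) (a : K) (x : V) :
  norm (scal a x) = abs a * norm x.
Proof.
apply Rle_antisym; [apply norm_scal|].
destruct (abs_ge_0 a) as [a0|<-]; [|rewrite Rmult_0_l; apply norm_ge_0].
destruct (scalars_inverse a0) as [b ba].
assert (E : abs b * abs a = 1) by now rewrite <- scalars_abs_mult, ba, abs_one.
assert (H := norm_scal b (scal a x)). rewrite scal_assoc, ba, scal_one in H.
apply Rmult_le_compat_l with (r := abs a) in H; [|now apply Rlt_le].
rewrite <- Rmult_assoc, (Rmult_comm (abs a) (abs b)), E in H. lra.
Qed.

(** With [c] a scalar of modulus [norm y], the map sending [a y] to [a c] on the line through [y] is
    extended; for [y = 0] the zero functional serves. *)
Lemma norming_functional (F : NormedModule K) (y : F) :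
  exists phi : F -> K, is_linear phi /\ (forall x, norm (phi x) <= norm x) /\
    norm (phi y) = norm y.
Proof.
destruct (Rle_lt_or_eq_dec _ _ (norm_ge_0 y)) as [y0|y0].
- destruct (scalars_abs_pos k y0) as [c Hc].
  destruct (@hahn_banach F (fun x r => exists a, x = scal a y /\ r = mult a c))
    as [phi [H1 [H2 H3]]].
  + split.
    * exists zero. now rewrite scal_zero_l, mult_zero_l.
    * intros x1 x2 r1 r2 [a [-> ->]] [b [-> ->]]. exists (plus a b).
      now rewrite scal_distr_r, mult_distr_r.
    * intros a x r [b [-> ->]]. exists (mult a b).
      rewrite scal_assoc. split; trivial. apply mult_assoc.
  + intros x r [a [-> ->]]. rewrite scalars_abs_mult, norm_scal_eq, Hc. apply Rle_refl.
  + exists phi. split; [|split]; trivial.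
    rewrite (H3 y c); [exact Hc|]. exists one. now rewrite scal_one, mult_one_l.
- exists (fun _ => @zero (NormedModule.AbelianMonoid K (AbsRing_NormedModule K))).
  split; [|split].
  + apply is_linear_zero.
  + intros x. rewrite norm_zero. apply norm_ge_0.
  + now rewrite norm_zero.
Qed.

(** * Contractions and the canonical injection *)

Lemma sup_norm_le1 (E F : NormedModule K) (f : E -> F) :
  (forall x, norm (f x) <= norm x) -> sup_norm f <= 1.
Proof.
intros H. apply supR_le; [lra|]. intros s [x [x1 ->]]. specialize (H x). lra.
Qed.

Lemma sup_norm_ge0 (E F : NormedModule K) (f : E -> F) :
  (forall x, norm (f x) <= norm x) -> 0 <= sup_norm f.
Proof.
intros H. apply supR_ge0 with 1. intros s [x [x1 ->]].
split; [apply norm_ge_0|]. specialize (H x). lra.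
Qed.

Lemma canonical_injection_linear (F : CompleteNormedModule K) :
  is_linear (@canonical_injection k F).
Proof.
split.
- intros x y. apply bounded_fun_eq. intros [phi [lin le1]]. exact (linear_plus phi lin x y).
- intros a x. apply bounded_fun_eq. intros [phi [lin le1]]. exact (linear_scal phi lin a x).
- exists 1. split; [lra|]. intros y. rewrite Rmult_1_l.
  apply bounded_norm_le; [apply norm_ge_0|]. intros phi. exact (dual_ball_bound y phi).
Qed.

(** Each coordinate is a contraction, and the coordinate of a norming functional of [y] attains
    [norm y]. *)
Lemma canonical_injection_metric (F : CompleteNormedModule K) :
  metric_injection (@canonical_injection k F).
Proof.
split; [apply canonical_injection_linear|]. intros y. apply Rle_antisym.
- apply bounded_norm_le; [apply norm_ge_0|]. intros phi. exact (dual_ball_bound y phi).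
- destruct (norming_functional y) as [phi [lin [le1 E]]]. rewrite <- E.
  exact (bounded_norm_ge (canonical_injection y)
    (exist _ phi (conj lin (sup_norm_le1 le1)))).
Qed.

Lemma canonical_injection_extension (F G : CompleteNormedModule K) (j : F -> G) :
  metric_injection j ->
  exists t : G -> linfty k (dual_ball F), is_linear t /\
    (forall z, norm (t z) <= norm z) /\ forall y, t (j y) = canonical_injection y.
Proof.
intros jinj.
assert (ext : forall phi : dual_ball F, exists psi : G -> K, is_linear psi /\
  (forall z, norm (psi z) <= norm z) /\ forall y, psi (j y) = proj1_sig phi y).
{ intros phi. apply functional_extension; trivial.
  apply (proj2_sig phi). intros y. apply dual_ball_bound. }
(* One extension [psi phi] is chosen per coordinate. All are contractions, so [norm z] bounds the
   family at [z] and [t z] is a bounded function. *)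
apply choice in ext. destruct ext as [psi Hpsi].
assert (bd : forall z, exists M : R, forall phi, norm (psi phi z) <= M).
{ intros z. exists (norm z). intros phi. apply Hpsi. }
set (t := fun z => exist _ (fun phi => psi phi z) (bd z) : linfty k (dual_ball F)).
assert (tle : forall z, norm (t z) <= norm z).
{ intros z. apply bounded_norm_le; [apply norm_ge_0|]. intros phi. apply Hpsi. }
exists t. split; [split|split]; trivial.
- intros x y. apply bounded_fun_eq. intros phi.
  exact (linear_plus _ (proj1 (Hpsi phi)) x y).
- intros a x. apply bounded_fun_eq. intros phi.
  exact (linear_scal _ (proj1 (Hpsi phi)) a x).
- exists 1. split; [lra|]. intros z. rewrite Rmult_1_l. apply tle.
- intros y. apply bounded_fun_eq. intros phi. apply Hpsi.
Qed.

(** This allows the hyper-ideal inequality to be used with an inner polynomial of degree 1. *)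
Lemma linear_hom_polynomial (E F : NormedModule K) (u : E -> F) :
  is_linear u -> hom_polynomial 1 u.
Proof.
intros lin. split; [|intros x; now apply linear_cont].
exists (fun x => u (x Fin.F1)). split; trivial.
assert (upd : forall (x : Fin.t 1 -> E) i v, update x i v Fin.F1 = v).
{ intros x i v. unfold update. destruct (Fin.eq_dec Fin.F1 i) as [|ne]; trivial.
  destruct ne. symmetry. apply (Fin.caseS' i); trivial.
  intros i'. now apply Fin.case0. }
intros x i. split; intros; rewrite !upd.
- now apply linear_plus.
- now apply linear_scal.
Qed.

(** * Injectivity and the injective hull *)

Notation Banach := (CompleteNormedModule K).

Lemma injective_iff_hull (Q : poly_class k) :
  polynomial_ideal Q -> (injective_class Q <-> same_class Q (injective_hull Q)).
Proof.
intros ideal. split.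
- intros inj E F P. split.
  + intros QP.
    (* The hull is a union over degrees, so a degree of [P] is fixed first; the ideal property is
       then used with the canonical injection outside and the identity inside. *)
    destruct (class_polynomial (ideal_components ideal) QP) as [m [m0 hom]].
    exists m. split; [|split]; trivial.
    exact (ideal_comp ideal m0 (canonical_injection_linear F) (conj hom QP) is_linear_id).
  + intros [m [m0 [hom comp]]].
    (* Injectivity is applied with the canonical injection as [j]. *)
    exact (proj2 (inj m E F _ P _ m0 hom (canonical_injection_metric F) comp)).
- intros same m E F G P j m0 hom jinj comp. split; trivial. apply same.
  exists m. split; [|split]; trivial.
  destruct (canonical_injection_extension jinj) as [t [lin [_ tj]]].
  assert (H := ideal_comp ideal m0 lin comp is_linear_id).
  replace (fun x => canonical_injection (P x)) with (fun x => t (j (P x))); trivial.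
  apply boolp.funext. intros x. apply tj.
Qed.

(** The ideal inequality is taken with the identity as inner operator. The sup norm of the identity
    is only bounded by 1, since it is 0 on the trivial space. *)
Lemma normed_ideal_contraction (Q : poly_class k) (N : class_norm k) (m : nat)
    (E F G : Banach) (P : E -> F) (t : F -> G) :
  normed_polynomial_ideal Q N -> (0 < m)%nat -> component Q m P ->
  is_linear t -> (forall y, norm (t y) <= norm y) ->
  N E G (fun x => t (P x)) <= N E F P.
Proof.
intros normed m0 comp lin tle.
assert (N0 := class_norm_ge0 (normed_ideal_norm normed) m0 comp).
assert (idle : forall x : E, norm ((fun x : E => x) x) <= norm x)
  by (intros; apply Rle_refl).
eapply Rle_trans; [apply (normed_ideal_comp normed m0 lin comp is_linear_id)|].
assert (t1 := sup_norm_le1 tle). assert (t0 := sup_norm_ge0 tle).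
assert (i1 := pow_incr _ 1 m (conj (sup_norm_ge0 idle) (sup_norm_le1 idle))).
assert (i0 := pow_le _ m (sup_norm_ge0 idle)). rewrite pow1 in i1.
rewrite <- (Rmult_1_r (N E F P)) at 2. apply Rmult_le_compat; trivial.
- now apply Rmult_le_pos.
- rewrite <- (Rmult_1_l (N E F P)) at 2. now apply Rmult_le_compat_r.
Qed.

Lemma normed_injective_iff_hull (Q : poly_class k) (N : class_norm k) :
  normed_polynomial_ideal Q N ->
  (injective_normed_class Q N <->
   same_class Q (injective_hull Q) /\ same_norm_on Q N (injective_hull_norm N)).
Proof.
intros normed. assert (ideal := normed_ideal_ideal normed).
unfold injective_normed_class. rewrite (injective_iff_hull ideal).
split; intros [same iso]; split; trivial.
- intros E F P QP. destruct (proj1 (same E F P) QP) as [m [m0 [hom comp]]].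
  exact (iso m E F _ P _ m0 hom (canonical_injection_metric F) comp).
- intros m E F G P j m0 hom jinj comp.
  assert (compP : component Q m P)
    by exact (proj2 (injective_iff_hull ideal) same m E F G P j m0 hom jinj comp).
  apply Rle_antisym.
  (* The norm of [P] is that of the canonical injection after [P], which factors as the contraction
     [t] after [j o P]. *)
  + rewrite (iso E F P (proj2 compP)). unfold injective_hull_norm.
    destruct (canonical_injection_extension jinj) as [t [lin [tle tj]]].
    replace (fun x => canonical_injection (P x)) with (fun x => t (j (P x)))
      by (apply boolp.funext; intros x; apply tj).
    exact (normed_ideal_contraction normed m0 comp lin tle).
  (* Conversely, [j] is itself a contraction. *)
  + apply (normed_ideal_contraction normed m0 compP (proj1 jinj)).
    intros y. right. apply jinj.
Qed.

Lemma normed_hyper_ideal_ideal (Q : poly_class k) (N : class_norm k) :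
  normed_polynomial_hyper_ideal Q N -> normed_polynomial_ideal Q N.
Proof.
intros [hyper ax comp]. split; trivial.
- exact (hyper_ideal_ideal hyper).
- intros m E F G H t P u m0 lint compP linu.
  exact (comp m 1%nat E F G H t P u m0 Nat.lt_0_1 lint compP (linear_hom_polynomial linu)).
Qed.

End Scalars.

Theorem corollary2p4 (k : scalar_field) :
  (forall Q : poly_class k, polynomial_ideal Q ->
     (injective_class Q <-> same_class Q (injective_hull Q))) /\
  (forall Q : poly_class k, polynomial_hyper_ideal Q ->
     (injective_class Q <-> same_class Q (injective_hull Q))) /\
  (forall (Q : poly_class k) (N : class_norm k), normed_polynomial_ideal Q N ->
     (injective_normed_class Q N <->
      same_class Q (injective_hull Q) /\
      same_norm_on Q N (injective_hull_norm N))) /\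
  (forall (Q : poly_class k) (N : class_norm k), normed_polynomial_hyper_ideal Q N ->
     (injective_normed_class Q N <->
      same_class Q (injective_hull Q) /\
      same_norm_on Q N (injective_hull_norm N))) /\
  (forall (Q : poly_class k) (N : class_norm k), banach_polynomial_ideal Q N ->
     (injective_normed_class Q N <->
      same_class Q (injective_hull Q) /\
      same_norm_on Q N (injective_hull_norm N))) /\
  (forall (Q : poly_class k) (N : class_norm k), banach_polynomial_hyper_ideal Q N ->
     (injective_normed_class Q N <->
      same_class Q (injective_hull Q) /\
      same_norm_on Q N (injective_hull_norm N))).
Proof.
split; [|split; [|split; [|split; [|split]]]].
- exact (@injective_iff_hull k).
- intros Q hyper. exact (injective_iff_hull (hyper_ideal_ideal hyper)).
- exact (@normed_injective_iff_hull k).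
- intros Q N hyper. exact (normed_injective_iff_hull (normed_hyper_ideal_ideal hyper)).
- intros Q N [normed _]. exact (normed_injective_iff_hull normed).
- intros Q N [hyper _]. exact (normed_injective_iff_hull (normed_hyper_ideal_ideal hyper)).
Qed.
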